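(* Let $R$ be a commutative domain, $n\ge1$, and $\phi$ an $R$-algebra automorphism of the Dirac quantum (Weyl) algebra $A_n(R)$. Then $\deg(\phi^{-1})\le \deg(\phi)^{2n-1}$.
   Context: $A_n(R)$ is the associative $R$-algebra generated by $Y_1,\ldots,Y_{2n}$ with relations $[Y_i,Y_{j+n}]=\delta_{ij}$, $[Y_i,Y_j]=0$, $[Y_{i+n},Y_{j+n}]=0$ for $1\le i,j\le n$. It is a free $R$-module with basis the ordered monomials $Y_1^{a_1}\cdots Y_{2n}^{a_{2n}}$; for nonzero $a\in A_n(R)$, $\deg(a)$ is the maximal total degree $a_1+\cdots+a_{2n}$ of a monomial occurring in $a$ with nonzero coefficient. For a nonzero endomorphism $\phi$, $\deg(\phi)=\max_{1\le i\le 2n}\deg(\phi(Y_i))$. *)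

(* Defs.v *)
From HB Require Import structures.
From mathcomp Require Import all_boot all_order all_algebra.
From mathcomp Require Import mpoly.
Set Implicit Arguments. Unset Strict Implicit. Unset Printing Implicit Defensive.
Import Order.TTheory GRing.Theory Num.Theory.
Local Open Scope ring_scope.

(* The Weyl algebra A_n(R) is realised on its R-basis of ordered monomials
   Y_1^{a_1} ... Y_{2n}^{a_{2n}}: an element is a finitely supported
   R-combination of such monomials, i.e. an element of {mpoly R[n + n]}
   where the exponent multinomial a : 'X_{1..n+n} encodes the ordered
   monomial.  Index j = lshift n i  <-> Y_{i+1}  (the "x_i"),
            index j = rshift n i  <-> Y_{i+1+n} (the "d_i").
   Only the R-module structure of mpoly is used; the multiplication is the
   Weyl product [wmul] below, NOT the commutative mpoly product. *)
Definition weyl (R : ringType) (n : nat) := {mpoly R[n + n]}.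

Section Weyl.
Variables (R : comRingType) (n : nat).

Definition wY (j : 'I_(n + n)) : weyl R n := 'X_j.

(* Normal ordering of a product of two ordered monomials, using the
   relations [Y_i, Y_{i+n}] = 1, i.e. d_i x_i = x_i d_i - 1, which gives
     d_i^b x_i^c = sum_k (-1)^k k! C(b,k) C(c,k) x_i^(c-k) d_i^(b-k),
   different index pairs commuting.  For m = x^a d^b and m' = x^c d^e:
     m * m' = sum_{k <= min(b,c)} prod_i (-1)^{k_i} k_i! C(b_i,k_i) C(c_i,k_i)
              x^(a+c-k) d^(b-k+e). *)
Definition wmon_res (m m' : 'X_{1..n + n}) (k : 'I_n -> nat) : 'X_{1..n + n} :=
  [multinom (match split j with
             | inl i => (m j + m' j - k i)%N
             | inr i => (m j - k i + m' j)%N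
             end) | j < n + n].

Definition wmon_coef (m m' : 'X_{1..n + n}) (k : 'I_n -> nat) : R :=
  \prod_(i < n)
     ((-1) ^+ k i *
      ((k i)`! * 'C(m (rshift n i), k i) * 'C(m' (lshift n i), k i))%:R).

Definition wmonmul (m m' : 'X_{1..n + n}) : weyl R n :=
  \sum_(k : {ffun 'I_n -> 'I_(mdeg m).+1}
         | [forall i, (k i <= minn (m (rshift n i)) (m' (lshift n i)))%N])
     wmon_coef m m' (fun i => nat_of_ord (k i)) *:
       'X_[wmon_res m m' (fun i => nat_of_ord (k i))].

Definition wmul (p q : weyl R n) : weyl R n :=
  \sum_(m <- msupp p) \sum_(m' <- msupp q) (p@_m * q@_m') *: wmonmul m m'.

(* deg a = maximal total degree of an ordered monomial in the support of a
   (msize a = 1 + that degree for a != 0). *)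
Definition wdeg (a : weyl R n) : nat := (msize a).-1.

Definition is_walg_endo (phi : weyl R n -> weyl R n) : Prop :=
  [/\ forall a b, phi (a + b) = phi a + phi b,
      forall (c : R) a, phi (c *: a) = c *: phi a,
      forall a b, phi (wmul a b) = wmul (phi a) (phi b)
    & phi 1 = 1].

Definition endo_deg (phi : weyl R n -> weyl R n) : nat :=
  \max_(j < n + n) wdeg (phi (wY j)).

End Weyl.

(* Main.v *)
(** Passing to leading monomials for the graded order turns the Weyl product
    into addition of exponents, so no reduction to positive characteristic and
    no geometry is needed: the bound comes from counting. Let [N = 2n],
    [d = deg phi], [G = phi^-1(Y_i)] of degree [delta], with leading exponent
    [alpha]. For [|e| <= T] and [c < d delta], write [e = a + b alpha] with
    [alpha] not componentwise below [a], and consider [Y^a G^(d delta b + c)]. Its leading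
    exponent [a + (d delta b + c) alpha] determines [(e, c)], so these elements
    are linearly independent; since [phi G = Y_i], their images under [phi] have
    degree at most [d |a| + d delta b + c = d |e| + c <= d T + d delta]. Hence
    [d delta C(N + T, N) <= C(N + d T + d delta, N)] for all [T], and comparing
    the growth in [T] gives [d delta <= d^N]. *)
Require Import Defs.
From HB Require Import structures.
From mathcomp Require Import all_boot all_order all_algebra.
From mathcomp Require Import mpoly.
From mathcomp Require Import zify.
Set Implicit Arguments.
Unset Strict Implicit.

Import Order.TTheory GRing.Theory Num.Theory.
Local Open Scope ring_scope.

(** * Comparison of the Weyl product with the commutative product *)

Lemma wmon_res0 n (m m' : 'X_{1..n + n}) (k : 'I_n -> nat) :
  (forall i, k i = 0%N) -> wmon_res m m' k = (m + m')%MM.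
Proof.
move=> k0; apply/mnmP => j; rewrite !mnmE.
by case: split => i; rewrite k0 subn0.
Qed.

(** Each contraction of a [d_i] with an [x_i] deletes both letters, so the degree drops by two. *)
Lemma mdeg_wmon_res n (m m' : 'X_{1..n + n}) (k : 'I_n -> nat) :
    (forall i, k i <= minn (m (rshift n i)) (m' (lshift n i)))%N ->
  (mdeg (wmon_res m m' k) + (\sum_i k i).*2 = mdeg m + mdeg m')%N.
Proof.
move=> le_k; rewrite -mdegD !mdegE !big_split_ord /= -addnn.
rewrite -!big_split /=; apply: eq_bigr => i _; rewrite !mnmE.
by rewrite (unsplitK (inl i)) (unsplitK (inr i)); have := le_k i; lia.
Qed.

(** The term [k = 0] is the commutative product with coefficient 1; every other term involves a
    contraction. As [msize] is the degree plus one, the bound says that the degree drops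
    strictly. *)
Lemma msize_wmonmul (R : comNzRingType) n (m m' : 'X_{1..n + n}) :
  (msize (wmonmul R m m' - 'X_[(m + m')%MM] : {mpoly R[n + n]})
     <= mdeg m + mdeg m')%N.
Proof.
pose k0 : {ffun 'I_n -> 'I_(mdeg m).+1} := [ffun => ord0].
rewrite /wmonmul (bigD1 k0) /=; last by apply/forallP => i; rewrite ffunE.
rewrite wmon_res0 => [|i]; last by rewrite ffunE.
rewrite {1}/wmon_coef big1 ?scale1r => [|i _]; last first.
  by rewrite ffunE /= !bin0 fact0 mul1r.
rewrite [X in X - _]addrC addrK; apply: leq_trans (msize_sum _ _ _) _.
apply/bigmax_leqP => k /andP[/forallP le_k nz_k].
apply: leq_trans (msizeZ_le _ _) _; rewrite msizeX.
rewrite -(mdeg_wmon_res le_k) -addn1 leq_add2l.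
rewrite double_gt0 lt0n; apply: contraNneq nz_k => /eqP.
rewrite sum_nat_eq0 => /forallP k_eq0; apply/eqP/ffunP => i.
by apply/val_inj; rewrite ffunE; apply/eqP; have := k_eq0 i.
Qed.

Lemma msize_wmul_sub (R : comNzRingType) n (p q : {mpoly R[n + n]}) :
  (msize (wmul p q - p * q : {mpoly R[n + n]}) <= wdeg p + wdeg q)%N.
Proof.
rewrite mpolyME big_allpairs /wmul -sumrB.
apply: leq_trans (msize_sum _ _ _) _; rewrite big_seq_cond.
apply/bigmax_leqP_seq => m; rewrite andbT => pm _ /=; rewrite -sumrB.
apply: leq_trans (msize_sum _ _ _) _; rewrite big_seq_cond.
apply/bigmax_leqP_seq => m'; rewrite andbT => qm _ /=; rewrite -scalerBr.
apply: leq_trans (msizeZ_le _ _) _; apply: leq_trans (msize_wmonmul _ _ _) _.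
rewrite /wdeg; have := msize_mdeg_lt pm; have := msize_mdeg_lt qm; lia.
Qed.

Lemma wdeg_wmul_le (R : idomainType) n (p q : {mpoly R[n + n]}) :
  (wdeg (wmul p q) <= wdeg p + wdeg q)%N.
Proof.
have le_pq : (msize (p * q) <= (wdeg p + wdeg q).+1)%N.
  have [->|nz_p] := eqVneq p 0; first by rewrite mul0r msize0.
  have [->|nz_q] := eqVneq q 0; first by rewrite mulr0 msize0.
  by rewrite msizeM // /wdeg -!mlead_deg //; lia.
rewrite {1}/wdeg -subn1 leq_subLR add1n.
rewrite -[X in msize X](subrK (p * q)); apply: leq_trans (msizeD_le _ _) _.
by rewrite geq_max le_pq andbT leqW // msize_wmul_sub.
Qed.

(** * Leading monomials and degrees of Weyl products *)

Section LeadingMonomials.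
Variables (R : idomainType) (n : nat).
Implicit Types p q : {mpoly R[n + n]}.

(** The correction [r] lies in degree below that of the leading monomial of [p * q], and the
    monomial order is graded, so [r] cannot disturb it. *)
Lemma mlead_wmul p q : p != 0 -> q != 0 ->
  (wmul p q : {mpoly R[n + n]}) != 0 /\
  mlead (wmul p q : {mpoly R[n + n]}) = (mlead p + mlead q)%MM.
Proof.
move=> nz_p nz_q; set r := (wmul p q - p * q : {mpoly R[n + n]}).
have le_r : (msize r <= mdeg (mlead p + mlead q)%MM)%N.
  by have := msize_wmul_sub p q; rewrite /wdeg -(mlead_deg nz_p) -(mlead_deg nz_q) mdegD.
have -> : wmul p q = p * q + r by rewrite addrC subrK.
have lead_pq : mlead (p * q + r) = (mlead p + mlead q)%MM.
  have [r0|nz_r] := eqVneq r 0; first by rewrite r0 addr0 mleadM.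
  by rewrite mleadDl mleadM //; apply: lt_mdeg_ltmc; rewrite mlead_deg.
split=> //; rewrite -mleadc_eq0 lead_pq mcoeffD -mleadM //.
rewrite [r@_ _]memN_msupp_eq0 ?addr0 ?mleadc_eq0 ?mulf_neq0 //.
by rewrite mleadM //; exact: msize_mdeg_ge.
Qed.

(* The Weyl product is not shown to be associative; the fixed bracketing of
   [wexp] and [wprod] is harmless because only leading monomials, degrees and
   the action of an endomorphism matter. *)
Definition wexp p (k : nat) : {mpoly R[n + n]} := iter k (wmul p) 1.

Definition wprod (F : 'I_(n + n) -> {mpoly R[n + n]}) (a : 'X_{1..n + n}) :
  {mpoly R[n + n]} := \big[@wmul R n/1]_j wexp (F j) (a j).

Lemma mlead_wexp p k : p != 0 ->
  wexp p k != 0 /\ mlead (wexp p k) = (mlead p *+ k)%MM.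
Proof.
move=> nz_p; elim: k => [|k [nz_k lead_k]]; first by rewrite /= oner_eq0 mlead1.
by rewrite /= mulmS -lead_k; exact: mlead_wmul.
Qed.

Lemma wdeg_wexp_le p k : (wdeg (wexp p k) <= wdeg p * k)%N.
Proof.
elim: k => [|k IHk]; first by rewrite /= /wdeg msizeC; case: (_ == _).
by rewrite mulnS /=; apply: leq_trans (wdeg_wmul_le _ _) _; rewrite leq_add2l.
Qed.

Lemma mlead_wprodY a : 
  wprod (@wY R n) a != 0 /\ mlead (wprod (@wY R n) a) = a.
Proof.
rewrite [X in _ /\ _ = X]multinomUE_id /wprod.
elim/big_rec2: _ => [|j p m _ [nz_m <-]]; first by rewrite /= oner_eq0 mlead1.
have nz_X : ('X_j : {mpoly R[n + n]}) != 0.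
  by apply/eqP => /(congr1 (fun p => msize p)); rewrite msizeX msize0.
have [nz_j lead_j] := mlead_wexp (a j) nz_X.
by have := mlead_wmul nz_j nz_m; rewrite lead_j mleadXm.
Qed.

Lemma wdeg_wprod_le F d a : (forall j, wdeg (F j) <= d)%N ->
  (wdeg (wprod F a) <= d * mdeg a)%N.
Proof.
move=> le_d; rewrite mdegE big_distrr /= /wprod.
elim/big_rec2: _ => [|j s p _ le_s]; first by rewrite /wdeg msizeC; case: (_ == _).
apply: leq_trans (wdeg_wmul_le _ _) _; apply: leq_add => //.
by apply: leq_trans (wdeg_wexp_le _ _) _; rewrite leq_mul2r le_d orbT.
Qed.

Variable phi : weyl R n -> weyl R n.
Hypothesis phi_endo : is_walg_endo phi.

Lemma endo_wexp p k : phi (wexp p k) = wexp (phi p) k.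
Proof. by case: phi_endo => _ _ phiM phi1; elim: k => //= k <-. Qed.

Lemma endo_wprod F a : phi (wprod F a) = wprod (phi \o F) a.
Proof.
case: phi_endo => _ _ phiM phi1; rewrite /wprod (big_morph phi phiM phi1).
by apply: eq_bigr => j _; rewrite endo_wexp.
Qed.

End LeadingMonomials.

(** * Linear relations over a domain, through its fraction field *)

Lemma fraction_common_denom (R : idomainType) m (v : 'rV[{fraction R}]_m) :
  exists2 d : R, d != 0 &
  exists w : 'rV[R]_m, map_mx (@tofrac R) w = (tofrac d) *: v.
Proof.
have frac_repr (x : {fraction R}) :
    exists nd : R * R, (nd.2 != 0) && (x * tofrac nd.2 == tofrac nd.1).
  elim/quotW: x => x; exists (frac x) => /=; rewrite denom_ratioP /=.
  apply/eqP; rewrite /GRing.mul /=.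
  rewrite !piE; apply/eqmodP; rewrite /= equivfE /FracField.mulf.
  by rewrite !numden_Ratio ?mulf_neq0 ?denom_ratioP ?oner_eq0 // !mulr1 mulrC.
have [f fP] := fin_all_exists (fun j => frac_repr (v 0 j)).
exists (\prod_j (f j).2).
  by apply/prodf_neq0 => j _; case/andP: (fP j).
exists (\row_j ((f j).1 * \prod_(i | i != j) (f i).2)).
apply/rowP => j; rewrite !mxE [in RHS](bigD1 j) //= !rmorphM /=.
by case/andP: (fP j) => _ /eqP <-; rewrite -mulrA [RHS]mulrC.
Qed.

(** The rank bound gives a kernel vector over the fraction field; clearing denominators brings it
    back to [R]. *)
Lemma exists_linear_relation (R : idomainType) m p (A : 'M[R]_(m, p)) :
  (p < m)%N -> exists2 u : 'rV_m, u != 0 & u *m A = 0.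
Proof.
move=> lt_pm; set B := map_mx (@tofrac R) A.
have : kermx B != 0.
  rewrite -mxrank_eq0 mxrank_ker subn_eq0 -ltnNge.
  exact: leq_ltn_trans (rank_leq_col _) lt_pm.
case/rowV0Pn => v /sub_kermxP vB0 nz_v.
have [d nz_d [w w_def]] := fraction_common_denom v.
exists w.
  apply: contra nz_v => /eqP w0; move/eqP: w_def.
  by rewrite w0 map_mx0 eq_sym scaler_eq0 tofrac_eq0 (negbTE nz_d).
apply/matrixP => i j; apply/eqP; rewrite [X in _ == X]mxE -tofrac_eq0.
have /matrixP/(_ i j) : map_mx (@tofrac R) (w *m A) = 0.
  by rewrite map_mxM w_def -scalemxAl vB0 scaler0.
by rewrite !mxE => ->.
Qed.

(** * Counting monomials and comparing growth *)

Lemma card_bmultinom k D : #|{: 'X_{1..k < D.+1}}| = 'C(k + D, k).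
Proof.
pose f (m : 'X_{1..k < D.+1}) : k.-tuple 'I_D.+1 := [tuple inord (m i) | i < k].
have f_val (m : 'X_{1..k < D.+1}) i : tnth (f m) i = m i :> nat.
  rewrite tnth_mktuple inordK // (leq_ltn_trans _ (bmdeg m)) //.
  by rewrite mdegE (bigD1 i) //= leq_addr.
have f_inj : injective f.
  move=> m1 m2 eq_f; apply/val_inj/mnmP => i.
  by rewrite -!f_val eq_f.
(* The image of [f] is the set of tuples with entry sum at most [D], whose cardinal is known. *)
rewrite -card_partial_ord_partitions -cardsT -(card_imset _ f_inj).
apply: eq_card => t; rewrite inE big_tuple; apply/imsetP/idP.
  case=> m _ ->; under eq_bigr do rewrite f_val.
  by rewrite -mdegE -ltnS bmdeg.
move=> le_t; have lt_m : (mdeg [multinom (tnth t i : nat) | i < k] < D.+1)%N.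
  by rewrite ltnS mdegE; under eq_bigr do rewrite mnmE.
exists (BMultinom lt_m) => //; apply/eq_from_tnth => i; apply/val_inj.
by rewrite [RHS]f_val /= mnmE.
Qed.

(** In the binomial expansion, replacing every lower power of [x] by [x ^ N.-1] leaves the
    coefficient sum [(k.+1 ^ N).-1]. *)
Lemma expn_add_le k x N : (0 < x)%N ->
  ((x + k) ^ N <= x ^ N + x ^ N.-1 * (k.+1 ^ N).-1)%N.
Proof.
move=> x_gt0; case: N => [|N]; first by rewrite !expn0.
elim: N => [|N IHN]; first by rewrite !expn1 expn0; lia.
have c_gt0 : (0 < k.+1 ^ N.+1)%N by rewrite expn_gt0.
have y_gt0 : (0 < x ^ N)%N by rewrite expn_gt0 x_gt0.
rewrite /= in IHN *; rewrite expnS; apply: leq_trans (leq_mul (leqnn _) IHN) _.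
rewrite !(expnS x) (expnS k.+1 N.+1).
move: (k.+1 ^ N.+1)%N c_gt0 => [//|c] _ /=.
nia.
Qed.

Lemma leq_expn_bin T N : (T ^ N <= 'C(N + T, N) * N`!)%N.
Proof.
rewrite bin_ffact ffact_prod -[N in (_ ^ N)%N]card_ord -prod_nat_const.
by apply: leq_prod => i _; have := ltn_ord i; lia.
Qed.

Lemma bin_leq_expn T N : ('C(N + T, N) * N`! <= (N + T) ^ N)%N.
Proof.
rewrite bin_ffact ffact_prod -[N in (_ ^ N)%N]card_ord -prod_nat_const.
by apply: leq_prod => i _; exact: leq_subr.
Qed.

(** Both sides are polynomials in [T] of degree [N], with leading coefficients [c / N!] and
    [d ^ N / N!]. *)
Lemma bin_leading_coef_le N d K c :
    (0 < d)%N -> (forall T, c * 'C(N + T, N) <= 'C(N + (d * T + K), N))%N ->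
  (c <= d ^ N)%N.
Proof.
case: N => [|N] d_gt0 le_bin; first by have := le_bin 0%N; rewrite !bin0 muln1.
rewrite leqNgt; apply/negP => lt_c.
(* [M] is the remainder constant of [expn_add_le]. If [c > d ^ N.+1], comparison would force
   [T <= M * d ^ N], so this [T] is one too large. *)
pose M := ((N.+1 + K).+1 ^ N.+1).-1; pose T := (M * d ^ N).+1.
have le_c : (c * T ^ N.+1 <= (d * T + (N.+1 + K)) ^ N.+1)%N.
  apply: leq_trans (leq_mul (leqnn c) (leq_expn_bin T N.+1)) _.
  rewrite mulnA addnCA; apply: leq_trans (bin_leq_expn _ _).
  by rewrite leq_mul2r le_bin orbT.
have dT_gt0 : (0 < d * T)%N by rewrite muln_gt0 d_gt0.
have := leq_trans le_c (expn_add_le (N.+1 + K) N.+1 dT_gt0).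
apply/negP; rewrite -ltnNge; apply: leq_trans (leq_mul lt_c (leqnn _)).
rewrite mulSn addnC !expnMn ltn_add2r -/M mulnAC [(_ * M)%N]mulnC.
by rewrite [(T ^ N.+1)%N]expnS ltn_pmul2r // expn_gt0.
Qed.

(** * Division of exponents by a nonzero exponent *)

Lemma mnm_divmod n (m e : 'X_{1..n}) : m != 0%MM ->
  exists ab : 'X_{1..n} * nat,
    ~~ (m <= ab.1)%MM && (e == ab.1 + m *+ ab.2)%MM.
Proof.
rewrite -mdeg_eq0 -lt0n => m_gt0.
(* Subtract [m] while it fits componentwise; the degree decreases since [m] is nonzero. *)
have [k] := ubnP (mdeg e); elim: k e => // k IHk e lt_e.
have [le_me|nle_me] := boolP (m <= e)%MM; last first.
  by exists (e, 0%N); rewrite nle_me /= mulm0n addm0.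
have [|[a b] /= /andP[nle_ma /eqP def_e]] := IHk (e - m)%MM.
  by have := lt_e; rewrite -{1}(submK le_me) mdegD; lia.
exists (a, b.+1); rewrite nle_ma /= mulmSr addmA -def_e.
by rewrite submK.
Qed.

(** After cancelling common copies of [m], a copy left on one side would lie below the remainder on
    the other. *)
Lemma mnm_divmod_inj n (m a1 a2 : 'X_{1..n}) b1 b2 :
    ~~ (m <= a1)%MM -> ~~ (m <= a2)%MM ->
  (a1 + m *+ b1 = a2 + m *+ b2)%MM -> a1 = a2 /\ b1 = b2.
Proof.
elim: b1 b2 => [|b1 IHb] [|b2] nle1 nle2.
- by rewrite mulm0n !addm0.
- by rewrite mulm0n addm0 mulmSr addmA => a1_def; rewrite a1_def lem_addl in nle1.
- by rewrite mulm0n addm0 mulmSr addmA => a2_def; rewrite -a2_def lem_addl in nle2.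
rewrite !mulmSr !addmA => /addIm/IHb[] // -> ->; by [].
Qed.

(** * Independence from distinct leading monomials, and the dimension count *)

Lemma mlead_inj_free (R : idomainType) k (I : finType)
    (E : I -> {mpoly R[k]}) (u : I -> R) :
    (forall i, E i != 0) -> injective (fun i => mlead (E i)) ->
  \sum_i u i *: E i = 0 -> forall i, u i = 0.
Proof.
move=> nz_E E_inj uE0 i; apply/eqP/negPn/negP => nz_ui.
(* At the largest leading monomial with a nonzero coefficient, only the term [j] contributes. *)
pose j := [arg max_(j > i | u j != 0) mlead (E j)]%O.
have [nz_uj max_j] : u j != 0 /\ forall l, u l != 0 -> (mlead (E l) <= mlead (E j))%O.
  by rewrite /j; case: arg_maxP => // l nz_l max_l; split.
have := congr1 (mcoeff (mlead (E j))) uE0.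
rewrite raddf_sum mcoeff0 (bigD1 j) //= big1 ?addr0 => [/eqP|l ne_lj].
  by rewrite mcoeffZ mulf_eq0 (negbTE nz_uj) mleadc_eq0 (negbTE (nz_E j)).
rewrite mcoeffZ; have [-> | nz_ul] := eqVneq (u l) 0; first by rewrite mul0r.
rewrite mcoeff_gt_mlead ?mulr0 // lt_neqAle max_j // andbT.
by apply: contraNneq ne_lj => /E_inj ->.
Qed.

(** With more elements than monomials of degree at most [D], the images would satisfy a linear
    relation, which injectivity of [phi] pulls back to the independent family [E]. *)
Lemma card_mlead_inj_le (R : idomainType) n (I : finType)
    (phi : weyl R n -> weyl R n) (E : I -> {mpoly R[n + n]}) D :
    is_walg_endo phi -> injective phi ->
    (forall i, E i != 0) -> injective (fun i => mlead (E i)) ->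
    (forall i, wdeg (phi (E i)) <= D)%N ->
  (#|I| <= 'C(n + n + D, n + n))%N.
Proof.
case=> phiD phiZ _ _ phi_inj nz_E E_inj le_D; rewrite leqNgt; apply/negP.
have phi0 : phi 0 = 0 by apply: (addrI (phi 0)); rewrite -phiD !addr0.
rewrite -card_bmultinom => lt_card.
have [u nz_u uA0] := exists_linear_relation (\matrix_(i, j)
  (phi (E (enum_val i)) : {mpoly R[n + n]})@_(enum_val j : bmultinom (n + n) D.+1))
  lt_card.
case/negP: nz_u; apply/eqP/rowP => i; rewrite mxE.
apply: (@mlead_inj_free R _ _ (fun i => E (enum_val i)) (u 0)) => //.
  by move=> x y /E_inj/enum_val_inj.
apply: phi_inj; rewrite phi0 (big_morph phi phiD phi0).
under eq_bigr do rewrite phiZ.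
apply/mpolyP => m; rewrite raddf_sum mcoeff0 /=.
under eq_bigr do rewrite mcoeffZ.
have [lt_m|le_m] := ltnP (mdeg m) D.+1.
  have /rowP/(_ (enum_rank (BMultinom lt_m))) := uA0; rewrite !mxE; apply: etrans.
  by apply: eq_bigr => x _; rewrite !mxE enum_rankK.
apply: big1 => x _; rewrite memN_msupp_eq0 ?mulr0 // msize_mdeg_ge //.
by apply: leq_trans le_m; have := le_D (enum_val x); rewrite /wdeg; case: mmeasure.
Qed.

(** * Degree bound for preimages of the generators *)

Lemma endo_deg_gt0 (R : idomainType) n (phi : weyl R n -> weyl R n) :
  (0 < n)%N -> is_walg_endo phi -> injective phi -> (0 < endo_deg phi)%N.
Proof.
move=> n_gt0 [_ phiZ _ phi1] phi_inj; rewrite lt0n; apply/negP => /eqP d0.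
have j : 'I_(n + n) by apply: lshift; apply: Ordinal n_gt0.
have : (wdeg (phi (wY R j)) <= 0)%N.
  by rewrite -d0 /endo_deg (bigD1 j) //= leq_maxl.
rewrite /wdeg -subn1 leq_subLR addn0 => /msize1_polyC phiY_const.
(* An image of degree 0 is a scalar, and [phi] fixes scalars, so injectivity would make [Y_j] itself
   a scalar. *)
have : wY R j = (phi (wY R j))@_0%MM *: 1.
  by apply: phi_inj; rewrite phiZ phi1 {1}phiY_const -mul_mpolyC mulr1.
move/(congr1 (fun p : {mpoly R[n + n]} => msize p)).
by rewrite /wY msizeX mdeg1 -mul_mpolyC mulr1 msizeC; case: eqP.
Qed.

Lemma wdeg_inverse_le (R : idomainType) n (phi : weyl R n -> weyl R n)
    (G : {mpoly R[n + n]}) i :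
    (0 < n)%N -> is_walg_endo phi -> injective phi -> phi G = wY R i ->
  (wdeg G <= endo_deg phi ^ (n + n).-1)%N.
Proof.
move=> n_gt0 phi_endo phi_inj phiG; set d := endo_deg phi.
have d_gt0 : (0 < d)%N by exact: endo_deg_gt0.
have [-> // | G_gt0] := posnP (wdeg G).
have nz_G : G != 0 by apply: contraTneq G_gt0 => ->; rewrite /wdeg msize0.
pose alpha := mlead G.
have deg_alpha : mdeg alpha = wdeg G by rewrite /wdeg -mlead_deg.
have nz_alpha : alpha != 0%MM by rewrite -mdeg_eq0 deg_alpha -lt0n.
have degY : wdeg (wY R i) = 1%N by rewrite /wdeg /wY msizeX mdeg1.
have degphi j : (wdeg (phi (wY R j)) <= d)%N.
  by rewrite /d /endo_deg (bigD1 j) //= leq_maxl.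
(* The factor [d] cancelled here turns the exponent [2n] into [2n - 1]. *)
suff : (d * wdeg G <= d ^ (n + n))%N.
  have -> : (n + n = (n + n).-1.+1)%N by lia.
  by rewrite expnS leq_pmul2l.
apply: (bin_leading_coef_le (K := (d * wdeg G)%N)) => // T.
pose S := bmultinom (n + n) T.+1.
have [ab abP] := fin_all_exists (fun e : S => mnm_divmod e nz_alpha).
(* One copy of [alpha] in [e] accounts for [d * wdeg G] in the bound [d |e|], while each factor [G]
   costs only 1 after [phi]: hence this multiplier. Quotient and remainder recover [b] and [c]. *)
pose ex (x : 'I_(d * wdeg G) * S) := ((ab x.2).2 * (d * wdeg G) + x.1)%N.
pose E x : {mpoly R[n + n]} := wmul (wprod (@wY R n) (ab x.2).1) (wexp G (ex x)).
have EP x : E x != 0 /\ mlead (E x) = ((ab x.2).1 + alpha *+ ex x)%MM.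
  have [nzY leadY] := mlead_wprodY R (ab x.2).1.
  have [nzG leadG] := mlead_wexp (ex x) nz_G.
  by have := mlead_wmul nzY nzG; rewrite leadY leadG.
rewrite -card_bmultinom -[X in (X * _)%N]card_ord -card_prod.
apply: (card_mlead_inj_le phi_endo phi_inj (E := E)) => [x|x y|x].
- by case: (EP x).
- case: (EP x) (EP y) => _ -> [_ ->].
  have /andP[nx /eqP def_x] := abP x.2; have /andP[ny /eqP def_y] := abP y.2.
  case/(mnm_divmod_inj nx ny) => eq_a eq_ex.
  have dG_gt0 : (0 < d * wdeg G)%N by rewrite muln_gt0 d_gt0.
  have eq1 : x.1 = y.1.
    apply/val_inj; have := congr1 (modn^~ (d * wdeg G)%N) eq_ex.
    by rewrite /ex /= !modnMDl !modn_small.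
  have eq_b : (ab x.2).2 = (ab y.2).2.
    have := congr1 (divn^~ (d * wdeg G)%N) eq_ex.
    by rewrite /ex /= !divnMDl // !divn_small // !addn0.
  have eq2 : x.2 = y.2 by apply/val_inj; rewrite /= def_x def_y eq_a eq_b.
  by case: x y eq1 eq2 {nx ny def_x def_y eq_a eq_b eq_ex} => [? ?] [? ?] /= -> ->.
case: (phi_endo) => _ _ phiM _.
rewrite /E phiM (endo_wprod phi_endo) (endo_wexp phi_endo) phiG.
apply: leq_trans (wdeg_wmul_le _ _) _.
apply: leq_trans (leq_add (wdeg_wprod_le _ degphi) (wdeg_wexp_le _ _)) _.
rewrite degY mul1n; have /andP[_ /eqP def_x] := abP x.2.
have : (mdeg x.2 <= T)%N by rewrite -ltnS bmdeg.
rewrite def_x mdegD mdegMn deg_alpha => /(leq_mul (leqnn d)).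
rewrite mulnDr [(_ * ((ab _).2))%N]mulnC mulnCA /ex addnA => le_T.
exact: leq_add le_T (ltnW (ltn_ord _)).
Qed.

Unset Implicit Arguments.
Set Strict Implicit.

Theorem theorem2 (R : idomainType) (n : nat) (hn : (1 <= n)%N)
    (phi phiinv : weyl R n -> weyl R n) :
  is_walg_endo phi ->
  cancel phi phiinv -> cancel phiinv phi ->
  (endo_deg phiinv <= endo_deg phi ^ (n + n).-1)%N.
Proof.
move=> phi_endo phiK phiinvK; apply/bigmax_leqP => j _.
by apply: (wdeg_inverse_le hn phi_endo (can_inj phiK)); exact: phiinvK.
Qed.
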